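(* Let $F=F(S)$ be the free group over a set $S$ with $|S|\geq 2$. The linear map $\ell^\infty\rightarrow \mathrm{H}^2_{\mathrm{b}}(F,\mathbb{R})$, $\sigma\mapsto[\partial g_\sigma]_{\mathrm{b}}$, is injective.
   Context: Bounded cohomology: for a group $\Gamma$, let $C^n(\Gamma)$ be the space of maps $\Gamma^n\to\mathbb{R}$ and $C^n_{\mathrm{b}}(\Gamma)$ the subspace of bounded maps. The coboundary maps (trivial real coefficients) are, in the relevant degrees, $\partial f(x,y)=f(y)-f(xy)+f(x)$ for $f\in C^1(\Gamma)$ and $\partial f(x,y,z)=f(y,z)-f(xy,z)+f(x,yz)-f(x,y)$ for $f\in C^2(\Gamma)$. Then $\mathrm{H}^2_{\mathrm{b}}(\Gamma,\mathbb{R})=\ker(\partial:C^2_{\mathrm{b}}(\Gamma)\to C^3_{\mathrm{b}}(\Gamma))/\mathrm{im}(\partial:C^1_{\mathrm{b}}(\Gamma)\to C^2_{\mathrm{b}}(\Gamma))$, and $[\,\cdot\,]_{\mathrm{b}}$ denotes the class of a bounded 2-cocycle. A map $f:\Gamma\to\mathbb{R}$ is a quasi-morphism if $\sup_{x,y}|f(x)+f(y)-f(xy)|<\infty$; in that case $\partial f$ is a bounded 2-cocycle. An element $x\in F(S)$ is called a power if $x=s^k$ for some $s\in S$ and $k\in\mathbb{Z}$. Each non-trivial $x\in F$ has a unique shortest factorization into powers, called the factorization of $x$: $x=x_0\cdots x_n$ with $x_i=s_i^{k_i}$, $s_i\in S$, $k_i\in\mathbb{Z}\setminus\{0\}$,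 and $s_i\neq s_{i+1}$ for $0\le i<n$. $\ell^\infty$ is the space of bounded real sequences $\sigma=(\sigma(k))_{k\geq1}$. Each $\sigma\in\ell^\infty$ is extended to an odd function $\sigma:\mathbb{Z}\to\mathbb{R}$, i.e. $\sigma(-k)=-\sigma(k)$ and $\sigma(0)=0$. The map $g_\sigma:F\to\mathbb{R}$ is defined on powers by $g_\sigma(s^k)=\sigma(k)$, and for $x$ with factorization $x=x_0\cdots x_n$ by $g_\sigma(x)=\sum_{i=0}^n g_\sigma(x_i)$. Each $g_\sigma$ is a quasi-morphism. *)

(* Defs.v *)
From HB Require Import structures.
From mathcomp Require Import all_boot all_order all_algebra.
From mathcomp Require Import boolp functions reals.
From mathcomp Require Import zify ring lra.

Set Implicit Arguments.
Unset Strict Implicit.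
Unset Printing Implicit Defensive.

Import Order.TTheory GRing.Theory Num.Theory.

Local Open Scope ring_scope.

(* The quotient of a module by a submodule.  The library provides the quotient
   [{quot I}] as an abelian group only. *)
Section LmodQuotient.
Variables (K : pzRingType) (V : lmodType K) (I : submodClosed V).

(* [submodClosed] is stated over semirings, so that closure under opposites,
   needed by [Quotient.quot], has to be recovered over a ring. *)
Definition submod_zmod : {pred V} := I.

Lemma submod_zmod_closed : zmod_closed submod_zmod.
Proof. exact: GRing.submod_closedB (submodClosedP I). Qed.

HB.instance Definition _ :=
  GRing.isZmodClosed.Build V submod_zmod submod_zmod_closed.

Definition lmod_quot : Type := Quotient.quot submod_zmod.

HB.instance Definition _ := GRing.Zmodule.on lmod_quot.

Definition lmod_pi (v : V) : lmod_quot := (\pi_(Quotient.quot submod_zmod) v)%qT.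

Lemma lmod_pi_eq (u v : V) : lmod_pi u = lmod_pi v <-> u - v \in I.
Proof.
rewrite /lmod_pi; split=> [/eqP|h]; first by rewrite -Quotient.idealrBE.
by apply/eqP; rewrite -Quotient.idealrBE.
Qed.

Lemma lmod_piB : {morph lmod_pi : u v / u - v}.
Proof. by move=> u v; rewrite /lmod_pi raddfB. Qed.

Lemma lmod_piD : {morph lmod_pi : u v / u + v}.
Proof. by move=> u v; rewrite /lmod_pi raddfD. Qed.

Definition lmod_quot_scale (a : K) (q : lmod_quot) : lmod_quot :=
  lmod_pi (a *: repr (q : Quotient.quot submod_zmod)).

Lemma lmod_quot_scaleE (a : K) (v : V) :
  lmod_quot_scale a (lmod_pi v) = lmod_pi (a *: v).
Proof.
apply/lmod_pi_eq; rewrite -scalerBr rpredZ //.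
by apply/lmod_pi_eq; rewrite /lmod_pi reprK.
Qed.

Lemma lmod_piP (q : lmod_quot) : exists v, q = lmod_pi v.
Proof. by exists (repr (q : Quotient.quot submod_zmod)); rewrite /lmod_pi reprK. Qed.

Lemma lmod_quot_scalerA a b q :
  lmod_quot_scale a (lmod_quot_scale b q) = lmod_quot_scale (a * b) q.
Proof. by have [v ->] := lmod_piP q; rewrite !lmod_quot_scaleE scalerA. Qed.

Lemma lmod_quot_scale1r : left_id 1 lmod_quot_scale.
Proof. by move=> q; have [v ->] := lmod_piP q; rewrite lmod_quot_scaleE scale1r. Qed.

Lemma lmod_quot_scalerDr : right_distributive lmod_quot_scale +%R.
Proof.
move=> a p q; have [u ->] := lmod_piP p; have [v ->] := lmod_piP q.
by rewrite -lmod_piD !lmod_quot_scaleE scalerDr lmod_piD.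
Qed.

Lemma lmod_quot_scalerDl q : {morph lmod_quot_scale^~ q : a b / a + b}.
Proof.
move=> a b; have [v ->] := lmod_piP q.
by rewrite !lmod_quot_scaleE scalerDl lmod_piD.
Qed.

HB.instance Definition _ := GRing.Zmodule_isLmodule.Build K lmod_quot
  lmod_quot_scalerA lmod_quot_scale1r lmod_quot_scalerDr lmod_quot_scalerDl.

Lemma lmod_pi_is_linear : linear lmod_pi.
Proof. by move=> a u v; rewrite lmod_piD -lmod_quot_scaleE. Qed.

HB.instance Definition _ :=
  GRing.isLinear.Build K V lmod_quot *:%R lmod_pi lmod_pi_is_linear.

End LmodQuotient.

Section BoundedFunctions.
Variables (R : realType) (X : Type).

Definition bdd_pred : {pred X -> R^o} :=
  fun f => `[< exists M : R, forall x, `|f x| <= M >].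

Lemma bdd_submod : submod_closed bdd_pred.
Proof.
split=> [|a u v].
  by apply/asboolP; exists 0 => x; rewrite normr0.
move=> /asboolP[M hM] /asboolP[N hN]; apply/asboolP.
exists (`|a| * M + N) => x.
rewrite (le_trans (ler_normD _ _)) // lerD //.
by rewrite normrM ler_wpM2l.
Qed.

HB.instance Definition _ :=
  GRing.isSubmodClosed.Build R (X -> R^o) bdd_pred (GRing.submod_closed_semi bdd_submod).

Record bfun := Bfun { bfun_fun :> X -> R^o; _ : bfun_fun \in bdd_pred }.

HB.instance Definition _ := [isSub for bfun_fun].
HB.instance Definition _ := [Choice of bfun by <:].
HB.instance Definition _ := [SubChoice_isSubLmodule of bfun by <:].

Lemma bfunP (f : bfun) : exists M : R, forall x, `|f x| <= M.
Proof. by case: f => f /= /asboolP. Qed.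

Lemma bfun_eqP (f g : bfun) : (f =1 g) <-> f = g.
Proof. by split=> [h|-> //]; apply/val_inj/funext. Qed.

Definition mk_bfun (f : X -> R) (h : exists M : R, forall x, `|f x| <= M) :
  bfun := @Bfun f (asboolT h).

End BoundedFunctions.

Section BoundedCohomology.
Variables (R : realType) (G : groupType).

Definition cobound1 (f : G -> R) : G * G -> R :=
  fun p => f p.2 - f (p.1 * p.2)%g + f p.1.

Definition cobound2 (f : G * G -> R) : G * G * G -> R :=
  fun p => let: (x, y, z) := p in
    f (y, z) - f ((x * y)%g, z) + f (x, (y * z)%g) - f (x, y).

Lemma cobound1_bdd (f : bfun R G) :
  exists M : R, forall p, `|cobound1 f p| <= M.
Proof.
have [M hM] := bfunP f; exists (M + M + M) => p.
rewrite (le_trans (ler_normD _ _)) // lerD //.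
by rewrite (le_trans (ler_normB _ _)) // lerD.
Qed.

Lemma cobound2_bdd (f : bfun R (G * G)) :
  exists M : R, forall p, `|cobound2 f p| <= M.
Proof.
have [M hM] := bfunP f; exists (M + M + M + M) => -[[x y] z] /=.
rewrite (le_trans (ler_normB _ _)) // lerD //.
rewrite (le_trans (ler_normD _ _)) // lerD //.
by rewrite (le_trans (ler_normB _ _)) // lerD.
Qed.

Definition bcobound1 (f : bfun R G) : bfun R (G * G) :=
  mk_bfun (cobound1_bdd f).

Definition bcobound2 (f : bfun R (G * G)) : bfun R (G * G * G) :=
  mk_bfun (cobound2_bdd f).

Lemma bcobound1_is_linear : linear bcobound1.
Proof.
move=> a f g; apply/bfun_eqP => p.
by rewrite /= /cobound1 /= !fctE /GRing.scale /=; ring.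
Qed.

Lemma bcobound2_is_linear : linear bcobound2.
Proof.
move=> a f g; apply/bfun_eqP => -[[x y] z].
by rewrite /= /cobound2 /= !fctE /GRing.scale /=; ring.
Qed.

HB.instance Definition _ :=
  GRing.isLinear.Build R _ _ *:%R bcobound1 bcobound1_is_linear.
HB.instance Definition _ :=
  GRing.isLinear.Build R _ _ *:%R bcobound2 bcobound2_is_linear.

Lemma cobound21 (f : G -> R) p : cobound2 (cobound1 f) p = 0.
Proof. by case: p => [[x y] z]; rewrite /cobound2 /cobound1 /= mulgA; ring. Qed.

Definition bcocycle_pred : {pred bfun R (G * G)} := fun f => bcobound2 f == 0.

Lemma bcocycle_submod : submod_closed bcocycle_pred.
Proof.
split=> [|a u v]; first by apply/eqP; rewrite linear0.
by move=> /eqP hu /eqP hv; apply/eqP; rewrite bcobound2_is_linear hu hv scaler0 addr0.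
Qed.

HB.instance Definition _ :=
  GRing.isSubmodClosed.Build R (bfun R (G * G)) bcocycle_pred (GRing.submod_closed_semi bcocycle_submod).

Record bcocycle :=
  Bcocycle { bcocycle_val :> bfun R (G * G); _ : bcocycle_val \in bcocycle_pred }.

HB.instance Definition _ := [isSub for bcocycle_val].
HB.instance Definition _ := [Choice of bcocycle by <:].
HB.instance Definition _ := [SubChoice_isSubLmodule of bcocycle by <:].

Definition bcoboundary_pred : {pred bcocycle} :=
  fun z => `[< exists b : bfun R G, bcobound1 b = val z >].

Lemma bcoboundary_submod : submod_closed bcoboundary_pred.
Proof.
split=> [|a u v]; first by apply/asboolP; exists 0; rewrite !linear0.
move=> /asboolP[b hb] /asboolP[c hc]; apply/asboolP.
by exists (a *: b + c); rewrite !linearP /= hb hc.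
Qed.

HB.instance Definition _ :=
  GRing.isSubmodClosed.Build R bcocycle bcoboundary_pred (GRing.submod_closed_semi bcoboundary_submod).

Definition H2b : lmodType R := lmod_quot bcoboundary_pred.

Definition bclass (z : bcocycle) : H2b := lmod_pi bcoboundary_pred z.

Definition quasimorphism (f : G -> R) : Prop :=
  exists D : R, forall x y, `|f x + f y - f (x * y)%g| <= D.

Lemma quasimorphism_bdd (f : G -> R) (hf : quasimorphism f) :
  exists M : R, forall p, `|cobound1 f p| <= M.
Proof.
have [D hD] := hf; exists D => -[x y]; rewrite /cobound1 /=.
by have := hD x y; congr (`|_| <= _); ring.
Qed.

Lemma quasimorphism_bcocycle (f : G -> R) (hf : quasimorphism f) :
  mk_bfun (quasimorphism_bdd hf) \in bcocycle_pred.
Proof. by apply/eqP/bfun_eqP => p; exact: cobound21. Qed.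

Definition dcocycle (f : G -> R) (hf : quasimorphism f) : bcocycle :=
  Bcocycle (quasimorphism_bcocycle hf).

End BoundedCohomology.

(* The free group on S: words in the letters (s, true), standing for s, and
   (s, false), standing for s^-1, in which no letter is followed by its
   inverse; the product is concatenation followed by reduction. *)
Section FreeGroup.
Variable S : choiceType.

Definition letter : Type := (S * bool)%type.
Definition linv (a : letter) : letter := (a.1, ~~ a.2).
Definition reduced (w : seq letter) : bool :=
  sorted (fun a b => b != linv a) w.

Record freegroup := FreeGroup { fgword :> seq letter; _ : reduced fgword }.

HB.instance Definition _ := [isSub for fgword].
HB.instance Definition _ := [Choice of freegroup by <:].

Lemma freegroupP (x : freegroup) : reduced x. Proof. by case: x. Qed.

Definition push (a : letter) (w : seq letter) : seq letter :=
  if w is b :: w' then if b == linv a then w' else a :: w else [:: a].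
Definition reduce (w : seq letter) : seq letter := foldr push [::] w.

Lemma linvK : involutive linv.
Proof. by case=> s b; rewrite /linv /= negbK. Qed.

Lemma reduced_cons a w : reduced (a :: w) -> reduced w.
Proof. exact: path_sorted. Qed.

Lemma push_reduced a w : reduced w -> reduced (push a w).
Proof.
case: w => [//|b w] /=; case: ifP => [_ /path_sorted //|hb hw].
by rewrite /reduced /= hb.
Qed.

Lemma foldr_push_reduced u w : reduced w -> reduced (foldr push w u).
Proof. by move=> hw; elim: u => //= a u; exact: push_reduced. Qed.

Lemma reduce_reduced w : reduced (reduce w).
Proof. exact: foldr_push_reduced. Qed.

Lemma push_cons a w : reduced (a :: w) -> push a w = a :: w.
Proof. by case: w => [//|b w] /= /andP[/negbTE->]. Qed.

Lemma reduce_id w : reduced w -> reduce w = w.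
Proof.
elim: w => //= a w ih h; rewrite ih ?push_cons //.
exact: reduced_cons h.
Qed.

Lemma pushK a w : reduced w -> push (linv a) (push a w) = w.
Proof.
case: w => [|b w] h /=; first by rewrite linvK eqxx.
case: eqP => [eb|nb]; first by rewrite -eb push_cons.
by rewrite /= linvK eqxx.
Qed.

Lemma foldr_push_push a u w : reduced w ->
  foldr push w (push a u) = push a (foldr push w u).
Proof.
move=> hw; case: u => [//|b u] /=; case: eqP => [eb|//].
by rewrite eb -{1}[a]linvK pushK // foldr_push_reduced.
Qed.

Lemma foldr_push_reduce u w : reduced w ->
  foldr push w (reduce u) = foldr push w u.
Proof. by move=> hw; elim: u => //= a u ih; rewrite foldr_push_push // ih. Qed.

Lemma reduce_cat u v : reduce (u ++ v) = foldr push (reduce v) u.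
Proof. exact: foldr_cat. Qed.

Definition fgelt (w : seq letter) : freegroup := FreeGroup (reduce_reduced w).
Definition fgone : freegroup := fgelt [::].
Definition fgmul (x y : freegroup) : freegroup := fgelt (x ++ y).
Definition fginv (x : freegroup) : freegroup := fgelt (rev (map linv x)).

Lemma fgelt_val (x : freegroup) : fgelt x = x.
Proof. by apply/val_inj; rewrite /= reduce_id // freegroupP. Qed.

Lemma fgmul_elt u v : fgmul (fgelt u) (fgelt v) = fgelt (u ++ v).
Proof.
apply/val_inj; rewrite /= !reduce_cat foldr_push_reduce ?reduce_reduced //.
by rewrite (reduce_id (reduce_reduced v)).
Qed.

Lemma fgmulA : associative fgmul.
Proof.
move=> x y z; rewrite -[x]fgelt_val -[y]fgelt_val -[z]fgelt_val.
by rewrite !fgmul_elt catA.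
Qed.

Lemma fgmul1 : left_id fgone fgmul.
Proof. by move=> x; rewrite -[x]fgelt_val fgmul_elt. Qed.

Lemma fg1mul : right_id fgone fgmul.
Proof. by move=> x; rewrite -[x]fgelt_val fgmul_elt cats0. Qed.

Lemma reduce_cancel w v : reduce (rev (map linv w) ++ w ++ v) = reduce v.
Proof.
elim: w v => //= a w ih v; rewrite rev_cons cat_rcons reduce_cat /=.
by rewrite pushK ?reduce_reduced // -reduce_cat ih.
Qed.

Lemma fgmulV : left_inverse fgone fginv fgmul.
Proof.
move=> x; rewrite -{2}[x]fgelt_val fgmul_elt; apply/val_inj => /=.
by rewrite -{2}[val x]cats0 reduce_cancel.
Qed.

Lemma fgVmul : right_inverse fgone fginv fgmul.
Proof.
move=> x; rewrite -{1}[x]fgelt_val fgmul_elt; apply/val_inj => /=.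
have := reduce_cancel (rev (map linv x)) [::].
by rewrite cats0 map_rev revK mapK //; exact: linvK.
Qed.

HB.instance Definition _ := isGroup.Build freegroup
  fgmulA fgmul1 fg1mul fgmulV fgVmul.

Definition fgen (s : S) : freegroup := fgelt [:: (s, true)].

End FreeGroup.

Definition zexpg (G : groupType) (x : G) (k : int) : G :=
  match k with Posz n => (x ^+ n)%g | Negz n => (x ^- n.+1)%g end.

Section Zexpg.
Variables (G : groupType) (x : G).

Lemma zexpgS k : zexpg x (k + 1) = (x * zexpg x k)%g.
Proof.
case: k => [n|[|n]]; first by rewrite /= addn1 expgS.
  by rewrite /= expg1 mulgV.
have -> : Negz n.+1 + 1 = Negz n by rewrite !NegzE; lia.
by rewrite /= [in RHS]expgSr invgM mulVKg.
Qed.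

Lemma zexpgP k : zexpg x (k - 1) = (x^-1 * zexpg x k)%g.
Proof. by rewrite -{2}[k](subrK 1) zexpgS mulKg. Qed.

Lemma zexpgD k l : zexpg x (k + l) = (zexpg x k * zexpg x l)%g.
Proof.
elim/int_rect: k => [|n ih|n ih]; first by rewrite add0r mul1g.
  by rewrite -addn1 PoszD addrAC zexpgS ih mulgA -zexpgS.
by rewrite -addn1 PoszD opprD addrAC zexpgP ih mulgA -zexpgP.
Qed.

End Zexpg.

(* Factorizations into powers: a sequence of pairs (s_i, k_i) stands for the
   product of the s_i ^ k_i. *)
Section Factorization.
Variable S : choiceType.
Implicit Types (s : S) (p q : S * int) (l : seq (S * int)).
Implicit Types (x y : freegroup S).

Definition power p : freegroup S := zexpg (fgen p.1) p.2.
Definition powers_prod l : freegroup S := (\prod_(p <- l) power p)%g.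

Definition powers_reduced l : bool :=
  all (fun p => p.2 != 0) l && sorted (fun p q => p.1 != q.1) l.

Definition push_power p l : seq (S * int) :=
  if p.2 == 0 then l else
  if l is q :: l' then
    if p.1 == q.1 then
      if p.2 + q.2 == 0 then l' else (p.1, p.2 + q.2) :: l'
    else p :: l
  else [:: p].

Definition letter_power (a : letter S) : S * int :=
  (a.1, if a.2 then 1 else -1).

(* This is the unique shortest factorization of x into powers, see
   factorization_prod, factorization_reduced, factorization_uniq and
   factorization_shortest below. *)
Definition factorization x : seq (S * int) :=
  foldr (fun a => push_power (letter_power a)) [::] (fgword x).

Lemma powers_reduced_cons p l : powers_reduced (p :: l) =
  [&& p.2 != 0, (if l is q :: _ then p.1 != q.1 else true) & powers_reduced l].
Proof.
case: l => [|q l]; rewrite /powers_reduced /=; first by rewrite !andbT.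
by case: (p.2 != 0) => //=; case: (q.2 != 0) => //=; rewrite ?andbF // andbCA.
Qed.

Lemma push_power_reduced p l : powers_reduced l -> powers_reduced (push_power p l).
Proof.
rewrite /push_power; case: ifP => // p0.
case: l => [_|q l]; first by rewrite /powers_reduced /= p0.
case: eqP => [e|/eqP ne h]; last by rewrite powers_reduced_cons p0 ne h.
rewrite powers_reduced_cons => /and3P[q0 h1 h2]; case: ifP => // n0.
by rewrite powers_reduced_cons /= n0 h2 e h1.
Qed.

Lemma push_power_cons p l : powers_reduced (p :: l) -> push_power p l = p :: l.
Proof.
rewrite powers_reduced_cons /push_power => /and3P[/negbTE-> h _].
by case: l h => [//|q l /negbTE->].
Qed.

Lemma push_powerD s j k l : powers_reduced l ->
  push_power (s, j) (push_power (s, k) l) = push_power (s, j + k) l.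
Proof.
move=> hl; have [->|k0] := eqVneq k 0.
  by rewrite addr0 {2}/push_power eqxx.
have [->|j0] := eqVneq j 0; first by rewrite add0r {1}/push_power eqxx.
rewrite {2}/push_power /= (negbTE k0).
case: l hl => [_|[t n] l].
  by rewrite /push_power /= (negbTE j0) eqxx.
rewrite powers_reduced_cons /= => /and3P[n0 h hl].
have [e|ne] := eqVneq s t; last first.
  rewrite /push_power /= (negbTE j0) eqxx.
  by case: ifP => // _; rewrite (negbTE ne).
move: h; rewrite -{t}e => h.
have [kn|kn] := eqVneq (k + n) 0.
  rewrite push_power_cons; last by rewrite powers_reduced_cons /= j0 h hl.
  rewrite /push_power /= eqxx -addrA kn addr0 (negbTE j0).
  by case: eqP => // jk; congr ((_, _) :: _); lia.
rewrite /push_power /= (negbTE j0) eqxx addrA.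
by case: (eqVneq (j + k) 0) => // ->; rewrite add0r (negbTE n0).
Qed.

Definition push_powers l1 l2 : seq (S * int) := foldr push_power l2 l1.

Lemma push_powers_reduced l1 l2 :
  powers_reduced l2 -> powers_reduced (push_powers l1 l2).
Proof. by move=> h; elim: l1 => //= p l1; exact: push_power_reduced. Qed.

Lemma push_powers_cat l1 l2 :
  powers_reduced (l1 ++ l2) -> push_powers l1 l2 = l1 ++ l2.
Proof.
elim: l1 => //= p l1 ih h; rewrite ih; first exact: push_power_cons.
by move: h; rewrite powers_reduced_cons => /and3P[].
Qed.

Lemma power0 s : power (s, 0) = 1%g. Proof. by []. Qed.

Lemma powerD s j k : power (s, j + k) = (power (s, j) * power (s, k))%g.
Proof. exact: zexpgD. Qed.

Lemma powers_prod_push p l :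
  powers_prod (push_power p l) = (power p * powers_prod l)%g.
Proof.
case: p => s k; rewrite /push_power /powers_prod /=.
case: eqP => [->|_]; first by rewrite power0 mul1g.
case: l => [|[t n] l]; first by rewrite !big_cons big_nil.
rewrite big_cons /=; case: eqP => [<-|_]; last by rewrite !big_cons.
rewrite mulgA -powerD; case: eqP => [->|_]; last by rewrite big_cons.
by rewrite power0 mul1g.
Qed.

Definition push_letters (w : seq (letter S)) l : seq (S * int) :=
  foldr (fun a => push_power (letter_power a)) l w.

Lemma push_letters_reduced w l :
  powers_reduced l -> powers_reduced (push_letters w l).
Proof. by move=> h; elim: w => //= a w; exact: push_power_reduced. Qed.

Lemma push_letters_push a w l : powers_reduced l ->
  push_letters (push a w) l = push_power (letter_power a) (push_letters w l).
Proof.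
move=> hl; case: w => [//|b w] /=; case: eqP => [->|//] /=.
have -> : letter_power (linv a) = (a.1, - (letter_power a).2).
  by rewrite /letter_power /=; case: a.2; rewrite ?opprK.
rewrite {1}/letter_power push_powerD ?push_letters_reduced // addrN.
by rewrite /push_power eqxx.
Qed.

Lemma push_letters_reduce w l : powers_reduced l ->
  push_letters (reduce w) l = push_letters w l.
Proof. by move=> hl; elim: w => //= a w ih; rewrite push_letters_push // ih. Qed.

Lemma factorization_reduced x : powers_reduced (factorization x).
Proof. exact: push_letters_reduced. Qed.

Lemma push_lettersM x y l : powers_reduced l ->
  push_letters (x * y)%g l = push_letters x (push_letters y l).
Proof. by move=> hl; rewrite [LHS]push_letters_reduce // /push_letters foldr_cat. Qed.

Lemma push_letters_gen s l : push_letters (fgen s) l = push_power (s, 1) l.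
Proof. by []. Qed.

Lemma push_letters_power p l : powers_reduced l ->
  push_letters (power p) l = push_power p l.
Proof.
case: p => s k hl; rewrite /power /=; elim/int_rect: k => [|n ih|n ih] //.
- rewrite -addn1 PoszD zexpgS push_lettersM // ih push_letters_gen.
  by rewrite push_powerD // addrC.
- rewrite -addn1 PoszD opprD zexpgP push_lettersM // ih.
  by rewrite (addrC (- _)) -push_powerD.
Qed.

Lemma factorizationM p x :
  factorization (power p * x)%g = push_power p (factorization x).
Proof.
by rewrite [LHS]push_lettersM // push_letters_power ?factorization_reduced.
Qed.

Lemma factorization_powersM l x :
  factorization (powers_prod l * x)%g = push_powers l (factorization x).
Proof.
elim: l => [|p l ih]; first by rewrite /powers_prod big_nil mul1g.
by rewrite /powers_prod big_cons -mulgA factorizationM ih.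
Qed.

Lemma factorization_powers l :
  factorization (powers_prod l) = push_powers l [::].
Proof. by rewrite -[powers_prod l]mulg1 factorization_powersM. Qed.

Lemma power_letter a : power (letter_power a) = fgelt [:: a].
Proof. by case: a => s []; apply/val_inj. Qed.

Lemma factorization_prod x : powers_prod (factorization x) = x.
Proof.
rewrite -[RHS]fgelt_val /factorization; elim: (fgword x) => [|a w ih] /=.
  by rewrite /powers_prod big_nil.
by rewrite powers_prod_push ih power_letter [LHS]fgmul_elt.
Qed.

Lemma factorization_uniq l :
  powers_reduced l -> factorization (powers_prod l) = l.
Proof.
by move=> hl; rewrite factorization_powers push_powers_cat cats0.
Qed.

Lemma factorization_shortest l :
  (size (factorization (powers_prod l)) < size l)%N
  \/ factorization (powers_prod l) = l.
Proof.
rewrite factorization_powers; elim: l => [|p l ih]; first by right.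
have hr := @push_powers_reduced l [::] isT.
rewrite /=; set m := push_powers l [::] in ih hr *.
have : push_power p m = p :: m \/ (size (push_power p m) <= size m)%N.
  rewrite /push_power; case: ifP => _; first by right.
  case: {ih hr} m => [|q m]; first by left.
  case: ifP => _; last by left.
  by case: ifP => _; right => //=.
case: ih => [hs|->] [->|hp] /=.
- by left.
- by left; apply: leq_ltn_trans hp _; exact: ltnW.
- by right.
- by left.
Qed.

End Factorization.

Notation linfty R := (bfun R nat).

(* A sequence sigma(1), sigma(2), ... is indexed from 0: u n is sigma(n + 1).
   odd_ext u is its extension to an odd function on int; Negz n is -(n + 1). *)
Definition odd_ext (R : realType) (u : nat -> R) (k : int) : R :=
  match k with Posz 0 => 0 | Posz n.+1 => u n | Negz n => - u n end.

Section QuasiMorphism.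
Variables (R : realType) (S : choiceType).

Definition gsigma (sigma : linfty R) (x : freegroup S) : R :=
  \sum_(p <- factorization x) odd_ext sigma p.2.

Lemma odd_extN (u : nat -> R) k : odd_ext u (- k) = - odd_ext u k.
Proof. by case: k => [[|n]|n] /=; rewrite ?oppr0 ?opprK. Qed.

Lemma odd_ext_bdd (sigma : linfty R) :
  exists2 M : R, 0 <= M & forall k, `|odd_ext sigma k| <= M.
Proof.
have [M hM] := bfunP sigma.
have M0 : 0 <= M by exact: le_trans (hM 0%N).
by exists M => // -[[|n]|n] /=; rewrite ?normr0 ?normrN.
Qed.

Lemma gsigma_power (sigma : linfty R) s k :
  gsigma sigma (power (s, k)) = odd_ext sigma k.
Proof.
rewrite /gsigma -[power _]mulg1 factorizationM /push_power /=.
by case: eqP => [->|_]; rewrite ?big_nil ?big_seq1.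
Qed.

Lemma gsigma_quasimorphism (sigma : linfty R) : quasimorphism (gsigma sigma).
Proof.
have [M M0 hM] := odd_ext_bdd sigma; exists (M + M + M) => x y.
rewrite -{2}(factorization_prod x) /gsigma factorization_powersM.
set h := odd_ext _ in hM *.
have hx := factorization_reduced x; have hy := factorization_reduced y.
move: (factorization x) (factorization y) hx hy => l1 l2 {x y}.
elim/last_ind: l1 l2 => [|l1 [s k] ih] l2 h1 h2.
  by rewrite big_nil add0r subrr normr0 !addr_ge0.
have [hl1 k0] : powers_reduced l1 /\ k != 0.
  move: h1; rewrite /powers_reduced all_rcons => /andP[/andP[/= -> ->]].
  by rewrite -cats1 => /cat_sorted2[->].
have hcat q : q.1 = s -> q.2 != 0 -> forall l, powers_reduced (q :: l) ->
    powers_reduced (l1 ++ q :: l).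
  move=> qs q0 l; move: h1; rewrite /powers_reduced -cats1 !all_cat.
  move=> /andP[/andP[-> _] s1] /andP[/= -> s2] /=.
  case: l1 s1 {ih hl1} => [//|r l1] /=; rewrite !cat_path /= s2 andbT.
  by rewrite andbT qs.
case: l2 h2 => [|[t n] l2] h2.
  by rewrite push_powers_cat cats0 // big_nil addr0 subrr normr0 !addr_ge0.
move: (h2); rewrite powers_reduced_cons => /and3P[/= n0 hn hl2].
rewrite -cats1 /push_powers foldr_cat /= -/(push_powers _ _).
rewrite big_cat big_seq1 big_cons /= /push_power /= (negbTE k0).
have [st|st] := eqVneq s t; last first.
  rewrite push_powers_cat; last first.
    by apply: hcat; rewrite // powers_reduced_cons /= k0 st h2.
  rewrite big_cat !big_cons /=.
  by rewrite [X in `|X|](_ : _ = 0) ?normr0 ?addr_ge0 //; ring.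
have [kn|kn] := eqVneq (k + n) 0.
  have -> : n = - k by lia.
  rewrite /h odd_extN -/h; have := ih l2 hl1 hl2.
  by congr (`|_| <= _); ring.
rewrite push_powers_cat; last first.
  by apply: hcat; rewrite // powers_reduced_cons /= kn hl2 andbT st.
rewrite big_cat big_cons /=.
rewrite [X in `|X|](_ : _ = h k + h n - h (k + n)); last by ring.
rewrite (le_trans (ler_normB _ _)) // lerD //.
by rewrite (le_trans (ler_normD _ _)) // lerD.
Qed.

Definition gsigma_class (sigma : linfty R) : H2b R (freegroup S) :=
  bclass (dcocycle (gsigma_quasimorphism sigma)).

End QuasiMorphism.

(* Main.v *)
Require Import Defs.
From HB Require Import structures.
From mathcomp Require Import all_boot all_order all_algebra.
From mathcomp Require Import reals.
From mathcomp Require Import boolp functions.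
From mathcomp Require Import ring.

Set Implicit Arguments.
Unset Strict Implicit.
Unset Printing Implicit Defensive.

Import Order.TTheory GRing.Theory Num.Theory.

Local Open Scope ring_scope.

(** Linearity is inherited from that of [odd_ext], [gsigma] and [dcocycle].

    For injectivity, suppose that sigma and tau have the same image and put
    rho = sigma - tau.  A bounded primitive b of the difference of the two
    cocycles makes h = g_rho - b a homomorphism to the reals at bounded distance
    from g_rho ([bclass_dcocycle_eq]).  On the powers of a generator s the
    function g_rho takes the values of the bounded function rho, so that
    h(s^n) = n h(s) is bounded and h(s) = 0.  Hence h vanishes on the subgroup
    generated by two distinct generators s and t, and g_rho is bounded there.
    However, (s^k t^k)^n, written out, is already a factorization into powers,
    so g_rho takes the value 2 n rho(k) on it ([gsigma_alternating]); boundedness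
    in n forces rho(k) = 0. *)

Section RealHomomorphisms.
Variables (R : realType) (G : groupType).

Lemma bounded_mulrn_eq0 (c B : R) : (forall n, `|c *+ n| <= B) -> c = 0.
Proof.
move=> hB; apply/eqP; apply: contraT => c0.
have c_gt0 : 0 < `|c| by rewrite normr_gt0.
have B0 : 0 <= B by exact: le_trans (hB 0%N).
have := archi_boundP (divr_ge0 B0 (ltW c_gt0)); rewrite ltr_pdivrMr //.
by rewrite mulr_natl -normrMn ltNge hB.
Qed.

Definition real_hom (h : G -> R) : Prop :=
  forall x y, h (x * y)%g = h x + h y.

Lemma real_hom1 (h : G -> R) : real_hom h -> h 1%g = 0.
Proof. by move=> hh; apply: (addrI (h 1%g)); rewrite -hh mulg1 addr0. Qed.

Lemma real_homX (h : G -> R) : real_hom h ->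
  forall x n, h (x ^+ n)%g = h x *+ n.
Proof.
move=> hh x; elim=> [|n ih]; first exact: real_hom1.
by rewrite expgS hh ih mulrS.
Qed.

Lemma dcocycleP (a : R) (f g k : G -> R) (hf : quasimorphism f)
    (hg : quasimorphism g) (hk : quasimorphism k) :
  (forall x, k x = a * f x + g x) ->
  dcocycle hk = a *: dcocycle hf + dcocycle hg.
Proof.
move=> e; apply/val_inj/bfun_eqP => p.
by rewrite /= /cobound1 !e !fctE /GRing.scale /=; ring.
Qed.

(** If b is a bounded primitive of the difference of the two cocycles, then
    the coboundary of f - g - b vanishes, so f - g - b is a homomorphism. *)
Lemma bclass_dcocycle_eq (f g : G -> R) (hf : quasimorphism f)
    (hg : quasimorphism g) :
  bclass (dcocycle hf) = bclass (dcocycle hg) ->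
  exists2 h : G -> R, real_hom h &
    exists B : R, forall x, `|f x - g x - h x| <= B.
Proof.
move=> /lmod_pi_eq/asboolP[b hb]; have [B hB] := bfunP b.
exists (fun x => f x - g x - b x) => [x y|]; last first.
  by exists B => x; rewrite opprB addrC subrK.
have /bfun_eqP/(_ (x, y)) := hb; rewrite /= /cobound1 /= !fctE /= => exy.
have -> : b (x * y)%g = b x + b y
    - (f y - f (x * y)%g + f x - (g y - g (x * y)%g + g x)).
  by rewrite -[in RHS]exy; ring.
by ring.
Qed.

End RealHomomorphisms.

Section GSigma.
Variables (R : realType) (S : choiceType).

Lemma odd_extP (a : R) (u v : linfty R) k :
  odd_ext (a *: u + v) k = a * odd_ext u k + odd_ext v k.
Proof. by case: k => [[|n]|n] /=; rewrite ?fctE /GRing.scale /=; ring. Qed.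

Lemma gsigmaP (a : R) (u v : linfty R) (x : freegroup S) :
  gsigma (a *: u + v) x = a * gsigma u x + gsigma v x.
Proof.
rewrite /gsigma mulr_sumr -big_split /=.
by apply: eq_bigr => p _; rewrite odd_extP.
Qed.

Lemma gsigma_class_linear : linear (@gsigma_class R S).
Proof.
move=> a u v; rewrite /gsigma_class /bclass.
by rewrite (dcocycleP (gsigma_quasimorphism S u) (gsigma_quasimorphism S v)
  (gsigma_quasimorphism S _) (@gsigmaP a u v)) linearP.
Qed.

Lemma real_hom_powers (h : freegroup S -> R) : real_hom h ->
  forall l, h (powers_prod l) = \sum_(p <- l) h (power p).
Proof.
move=> hh; elim=> [|p l ih]; first by rewrite /powers_prod !big_nil real_hom1.
by rewrite /powers_prod !big_cons hh ih.
Qed.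

(** A homomorphism at bounded distance from [gsigma u] is bounded on the powers
    of a generator, because [gsigma u] is. *)
Lemma near_gsigma_gen (u : linfty R) (h : freegroup S -> R) (B : R) :
  real_hom h -> (forall x, `|gsigma u x - h x| <= B) ->
  forall s, h (fgen s) = 0.
Proof.
move=> hh hB s; have [M M0 hM] := odd_ext_bdd u.
apply: (@bounded_mulrn_eq0 _ _ (M + B)) => n.
rewrite -real_homX // -[X in `|X|](subKr (gsigma u (fgen s ^+ n)%g)).
rewrite (le_trans (ler_normB _ _)) // lerD //.
by rewrite -[(fgen s ^+ n)%g]/(power (s, Posz n)) gsigma_power.
Qed.

(** The factorization s^k t^k ... s^k t^k of (s^k t^k)^n. *)
Definition alternating (s t : S) (k : int) (n : nat) : seq (S * int) :=
  flatten (nseq n [:: (s, k); (t, k)]).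

Lemma alternating_reduced s t k n :
  s != t -> k != 0 -> powers_reduced (alternating s t k n).
Proof.
move=> st k0; elim: n => // n ih.
rewrite [alternating _ _ _ _]/= 2!powers_reduced_cons /= k0 st.
by rewrite [powers_reduced _]ih andbT; case: (n) => //= _; rewrite eq_sym.
Qed.

Lemma sum_alternating (F : S * int -> R) s t k n :
  \sum_(p <- alternating s t k n) F p = (F (s, k) + F (t, k)) *+ n.
Proof.
elim: n => [|n ih]; first by rewrite big_nil.
by rewrite /alternating /= !big_cons ih mulrS addrA.
Qed.

Lemma gsigma_alternating (u : linfty R) s t k n : s != t -> k != 0 ->
  gsigma u (powers_prod (alternating s t k n)) = odd_ext u k *+ 2 *+ n.
Proof.
move=> st k0; rewrite /gsigma factorization_uniq ?alternating_reduced //.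
by rewrite (sum_alternating (fun p => odd_ext u p.2)) -mulr2n.
Qed.

Lemma near_hom_gsigma_eq0 (u : linfty R) (h : freegroup S -> R) (B : R)
    (s t : S) :
  s != t -> real_hom h -> (forall x, `|gsigma u x - h x| <= B) -> u = 0.
Proof.
move=> st hh hB; apply/bfun_eqP => m.
(* The entry of index m is the value at the exponent m + 1. *)
have h0 r : h (power (r, Posz m.+1)) = 0.
  by rewrite /power /= real_homX // (near_gsigma_gen hh hB) mul0rn.
have : odd_ext u (Posz m.+1) *+ 2 = 0.
  apply: (@bounded_mulrn_eq0 _ _ B) => n.
  have := hB (powers_prod (alternating s t (Posz m.+1) n)).
  rewrite gsigma_alternating // real_hom_powers //.
  by rewrite (sum_alternating (h \o @power S)) /= !h0 addr0 mul0rn subr0.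
by move/eqP; rewrite mulrn_eq0 /= => /eqP.
Qed.

End GSigma.

Theorem proposition2p2 (R : realType) (S : choiceType)
    (hS : exists s t : S, s <> t) :
  linear (@gsigma_class R S) /\ injective (@gsigma_class R S).
Proof.
split=> [|u v]; first exact: gsigma_class_linear.
case: hS => s [t /eqP st] /bclass_dcocycle_eq[h hh [B hB]].
have e x : gsigma (u - v) x = gsigma u x - gsigma v x.
  by rewrite addrC -scaleN1r gsigmaP mulN1r addrC.
apply/eqP; rewrite -subr_eq0; apply/eqP.
by apply: (near_hom_gsigma_eq0 st hh) => x; rewrite e; exact: hB.
Qed.
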